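(* Let $(X,T)$ be a topological dynamical system (a continuous map $T:X\to X$ of a compact metric space $(X,d)$) and let $\mu$ be an ergodic $T$-invariant Borel probability measure. Let $\mathfrak B$ denote the Borel sigma-algebra of $X$ completed with respect to $\mu$. Then: (1) if $(X,\mathfrak B,\mu,T)$ is measure-theoretically chaotic, then $(X,T)$ is DC2 chaotic; (2) if $(X,\mathfrak B,\mu,T)$ is uniformly measure-theoretically chaotic, then $(X,T)$ is uniformly DC2 chaotic; (3) if $(X,\mathfrak B,\mu,T)$ is measure-theoretically$^+$ chaotic, then $(X,T)$ is DC$1\tfrac12$ chaotic; (4) if $(X,\mathfrak B,\mu,T)$ is uniformly measure-theoretically$^+$ chaotic, then $(X,T)$ is uniformly DC$1\tfrac12$ chaotic.
   Context: The upper density of an increasing sequence $(n_i)$ of positive integers is $\limsup_{N\to\infty}\frac1N\#\{i:n_i\le N\}$. Measure-theoretic notions. Let $T$ be a measure-preserving transformation of a standard probability space $(X,\mathfrak B,\mu)$ ($\mathfrak B$ complete). A sequence $(\mathscr P_k)_{k\ge1}$ of finite measurable partitions is refining if $\mathscr P_{k+1}$ refines $\mathscr P_k$ for every $k$ and $\mathfrak B$ is the smallest complete sigma-algebra containing all the $\mathscr P_k$. A pair $(x,y)$ is $(\mathscr P_k)$-scrambled if (i) there is an increasing sequence $n_i$ of upper density 1 such that for every $k$ and all large enough $i$, $T^{n_i}x$ and $T^{n_i}y$ lie in the same atom of $\mathscr P_k$; and (ii) there are an increasing sequence $m_i$ of positive upper density and an index $k_0$ such that for every $i$, $T^{m_i}x$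 and $T^{m_i}y$ lie in different atoms of $\mathscr P_{k_0}$. A pair $(x,y)$ is $(\mathscr P_k)^+$-scrambled if (i) holds and (ii$^+$) for every $\eta\in(0,1)$ there are an increasing sequence $m_{\eta,i}$ of upper density at least $\eta$ and an index $k_\eta$ such that for every $i$, $T^{m_{\eta,i}}x$ and $T^{m_{\eta,i}}y$ lie in different atoms of $\mathscr P_{k_\eta}$. A set is $(\mathscr P_k)$-scrambled (resp. $(\mathscr P_k)^+$-scrambled) if every pair of its distinct elements is. A $(\mathscr P_k)$-scrambled set is uniformly scrambled if $k_0$ can be chosen common to all pairs of distinct elements and the upper densities of the sequences $m_i$ have a common positive lower bound $\eta$. A $(\mathscr P_k)^+$-scrambled set is uniformly scrambled if the function $\eta\mapsto k_\eta$ can be chosen common to all pairs of distinct elements. The system is measure-theoretically (uniformly measure-theoretically, measure-theoretically$^+$, uniformly measure-theoretically$^+$) chaotic if for every refining sequence of finite measurable partitions $(\mathscr P_k)$ there exists an uncountable $(\mathscr P_k)$-scrambled (uniformly $(\mathscr P_k)$-scrambled, $(\mathscr P_k)^+$-scrambled, uniformly $(\mathscr P_k)^+$-scrambled) set. Topological notions. In a topological dynamical system $(X,T)$ with metric $d$, a pair $(x,y)$ is DC2-scrambled if (a) there is an increasing sequence $n_i$ of upper density 1 with $d(T^{n_i}x,T^{n_i}y)\to0$; and (b) there are an increasing sequence $m_i$ of positive upper density and $s>0$ with $d(T^{m_i}x,T^{m_i}y)\ge s$ for all $i$. A pair is DC$1\tfrac12$-scrambled if (a) holds and (b') for every $0<\eta<1$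 there are an increasing sequence $m_{\eta,i}$ of upper density at least $\eta$ and $s_\eta>0$ with $d(T^{m_{\eta,i}}x,T^{m_{\eta,i}}y)\ge s_\eta$ for all $i$. A set is DC2- (DC$1\tfrac12$-) scrambled if every pair of its distinct elements is. A DC2-scrambled set is uniformly scrambled if $s$ and a positive lower bound $\eta$ for the upper densities of the sequences $m_i$ can be chosen common to all pairs of distinct elements; a DC$1\tfrac12$-scrambled set is uniformly scrambled if the function $\eta\mapsto s_\eta$ can be chosen common to all pairs of distinct elements. $(X,T)$ is DC2 (uniformly DC2, DC$1\tfrac12$, uniformly DC$1\tfrac12$) chaotic if there exists an uncountable scrambled set of the corresponding type. *)

(* Defs.v *)
From HB Require Import structures.
From mathcomp Require Import all_boot all_order all_algebra finmap.
From mathcomp Require Import all_classical all_reals all_analysis.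
From mathcomp Require Import measurable_realfun.

Set Implicit Arguments.
Unset Strict Implicit.
Unset Printing Implicit Defensive.

Import Order.TTheory GRing.Theory Num.Theory.
Import numFieldNormedType.Exports.

Local Open Scope classical_set_scope.
Local Open Scope ring_scope.

(* Every measurableType is pointed, so a metric space must come with a point to
   carry its Borel sigma-algebra. The point plays no other role: a space that
   carries a probability measure is nonempty. *)
#[short(type="pointedMetricType")]
HB.structure Definition PointedMetric (K : numDomainType) :=
  {M of Pointed M & Metric K M}.

Section density.

Definition positive_increasing (n : nat -> nat) : Prop :=
  increasing_seq n /\ forall i, (0 < n i)%N.

(* [fset_set] is meaningful here because the set of indices is finite when [n]
   is increasing. The value at [N = 0] does not affect the limsup. *)
Definition upper_density (R : realType) (n : nat -> nat) : \bar R :=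
  limn_esup (fun N : nat =>
    ((#|` fset_set [set i | (n i <= N)%N] |)%:R / N%:R)%:E).

End density.

Definition scrambled_for (X : Type) (pair : X -> X -> Prop) (S : set X) :=
  forall x y, S x -> S y -> x <> y -> pair x y.

Section measure_preserving.
Context {d : measure_display} {X : measurableType d} {R : realType}.
Implicit Types (mu : probability X R) (f : X -> X).

Definition measure_preserving mu f : Prop :=
  measurable_fun setT f /\ forall A, measurable A -> mu (f @^-1` A) = mu A.

Definition ergodic mu f : Prop :=
  measure_preserving mu f /\
  forall A, measurable A -> f @^-1` A = A -> mu A = 0%E \/ mu A = 1%E.

End measure_preserving.

(* In this section the probability space is the completion of [X] under [mu]:
   its sigma-algebra is [completed_algebra_gen mu], the family of the sets
   [A `|` N] with [A] measurable and [N] negligible, and its null sets are the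
   [mu]-negligible sets. *)
Section measure_theoretic_chaos.
Context {d : measure_display} {X : measurableType d} {R : realType}.
Implicit Types (mu : probability X R) (f : X -> X).
Implicit Types (Q : set (set X)) (P : nat -> set (set X)) (S : set X).

Definition finite_measurable_partition mu Q : Prop :=
  [/\ finite_set Q, Q `<=` completed_algebra_gen mu & partition Q id [set: X]].

Definition refines (Q' Q : set (set X)) : Prop :=
  forall A, Q' A -> exists2 B, Q B & A `<=` B.

(* Completeness is that of the measure space obtained by restricting the
   completed measure to [G]. *)
Definition complete_sub_sigma_algebra mu (G : set (set X)) : Prop :=
  [/\ sigma_algebra [set: X] G, G `<=` completed_algebra_gen mu &
      forall N M, G N -> mu.-negligible N -> M `<=` N -> G M].

Definition refining_sequence mu P : Prop :=
  [/\ forall k, finite_measurable_partition mu (P k),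
      forall k, refines (P k.+1) (P k) &
      smallest (complete_sub_sigma_algebra mu) (\bigcup_k P k) =
        completed_algebra_gen mu].

Definition same_atom Q (x y : X) : Prop := exists A, [/\ Q A, A x & A y].

Definition different_atoms Q (x y : X) : Prop :=
  exists A B, [/\ Q A, Q B, A <> B, A x & B y].

Definition mt_proximal f P (x y : X) : Prop :=
  exists n : nat -> nat,
    [/\ positive_increasing n, upper_density R n = 1%E &
        forall k, \forall i \near \oo,
          same_atom (P k) (iter (n i) f x) (iter (n i) f y)].

Definition mt_separated_along f P (m : nat -> nat) (k : nat) (x y : X) : Prop :=
  forall i, different_atoms (P k) (iter (m i) f x) (iter (m i) f y).

Definition mt_scrambled_pair f P (x y : X) : Prop :=
  mt_proximal f P x y /\
  exists (m : nat -> nat) (k0 : nat),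
    [/\ positive_increasing m, (0 < upper_density R m)%E &
        mt_separated_along f P m k0 x y].

Definition mt_plus_scrambled_pair f P (x y : X) : Prop :=
  mt_proximal f P x y /\
  forall eta : R, 0 < eta < 1 ->
    exists (m : nat -> nat) (k : nat),
      [/\ positive_increasing m, (eta%:E <= upper_density R m)%E &
          mt_separated_along f P m k x y].

Definition mt_scrambled f P S : Prop := scrambled_for (mt_scrambled_pair f P) S.

Definition mt_plus_scrambled f P S : Prop :=
  scrambled_for (mt_plus_scrambled_pair f P) S.

Definition uniformly_mt_scrambled f P S : Prop :=
  mt_scrambled f P S /\
  exists (k0 : nat) (eta : R), 0 < eta /\
    scrambled_for (fun x y => exists m : nat -> nat,
      [/\ positive_increasing m, (eta%:E <= upper_density R m)%E &
          mt_separated_along f P m k0 x y]) S.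

Definition uniformly_mt_plus_scrambled f P S : Prop :=
  mt_plus_scrambled f P S /\
  exists k : R -> nat,
    scrambled_for (fun x y => forall eta : R, 0 < eta < 1 ->
      exists m : nat -> nat,
        [/\ positive_increasing m, (eta%:E <= upper_density R m)%E &
            mt_separated_along f P m (k eta) x y]) S.

Definition mt_chaotic mu f : Prop :=
  forall P, refining_sequence mu P ->
    exists S, ~ countable S /\ mt_scrambled f P S.

Definition uniformly_mt_chaotic mu f : Prop :=
  forall P, refining_sequence mu P ->
    exists S, ~ countable S /\ uniformly_mt_scrambled f P S.

Definition mt_plus_chaotic mu f : Prop :=
  forall P, refining_sequence mu P ->
    exists S, ~ countable S /\ mt_plus_scrambled f P S.

Definition uniformly_mt_plus_chaotic mu f : Prop :=
  forall P, refining_sequence mu P ->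
    exists S, ~ countable S /\ uniformly_mt_plus_scrambled f P S.

End measure_theoretic_chaos.

(* DC32 abbreviates DC1½. *)
Section topological_chaos.
Context {R : realType} {X : metricType R}.
Implicit Types (f : X -> X) (S : set X).

Definition top_proximal f (x y : X) : Prop :=
  exists n : nat -> nat,
    [/\ positive_increasing n, upper_density R n = 1%E &
        mdist (iter (n i) f x) (iter (n i) f y) @[i --> \oo] --> (0 : R)].

Definition top_separated_along f (m : nat -> nat) (s : R) (x y : X) : Prop :=
  forall i, s <= mdist (iter (m i) f x) (iter (m i) f y).

Definition DC2_scrambled_pair f (x y : X) : Prop :=
  top_proximal f x y /\
  exists (m : nat -> nat) (s : R),
    [/\ positive_increasing m, (0 < upper_density R m)%E, 0 < s &
        top_separated_along f m s x y].

Definition DC32_scrambled_pair f (x y : X) : Prop :=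
  top_proximal f x y /\
  forall eta : R, 0 < eta < 1 ->
    exists (m : nat -> nat) (s : R),
      [/\ positive_increasing m, (eta%:E <= upper_density R m)%E, 0 < s &
          top_separated_along f m s x y].

Definition DC2_scrambled f S : Prop := scrambled_for (DC2_scrambled_pair f) S.

Definition DC32_scrambled f S : Prop := scrambled_for (DC32_scrambled_pair f) S.

Definition uniformly_DC2_scrambled f S : Prop :=
  DC2_scrambled f S /\
  exists s eta : R, [/\ 0 < s, 0 < eta &
    scrambled_for (fun x y => exists m : nat -> nat,
      [/\ positive_increasing m, (eta%:E <= upper_density R m)%E &
          top_separated_along f m s x y]) S].

Definition uniformly_DC32_scrambled f S : Prop :=
  DC32_scrambled f S /\
  exists s : R -> R, (forall eta, 0 < eta < 1 -> 0 < s eta) /\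
    scrambled_for (fun x y => forall eta : R, 0 < eta < 1 ->
      exists m : nat -> nat,
        [/\ positive_increasing m, (eta%:E <= upper_density R m)%E &
            top_separated_along f m (s eta) x y]) S.

Definition DC2_chaotic f : Prop :=
  exists S, ~ countable S /\ DC2_scrambled f S.

Definition uniformly_DC2_chaotic f : Prop :=
  exists S, ~ countable S /\ uniformly_DC2_scrambled f S.

Definition DC32_chaotic f : Prop :=
  exists S, ~ countable S /\ DC32_scrambled f S.

Definition uniformly_DC32_chaotic f : Prop :=
  exists S, ~ countable S /\ uniformly_DC32_scrambled f S.

End topological_chaos.

(* Main.v *)
Require Import Defs.
From HB Require Import structures.
From mathcomp Require Import all_boot all_order all_algebra finmap.
From mathcomp Require Import all_classical all_reals all_analysis.
From mathcomp Require Import measurable_realfun zify lra.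

Import Order.TTheory GRing.Theory Num.Theory.
Import numFieldNormedType.Exports.

Local Open Scope classical_set_scope.
Local Open Scope ring_scope.

(** Measure-theoretic chaos provides scrambled sets for every refining sequence
of partitions, so it suffices to build one refining sequence for which
combinatorial scrambling forces metric scrambling.

Fix countably many balls, among which every scale has a finite subfamily
covering the compact space ([compact_fine_balls]), and let the [k]-th partition
be the one generated by the first [k] balls. Points in the same atom of a late
partition are in a common small ball, so proximality transfers at once
([proximal_transfer]). The obstacle is separation: points in different atoms
can be close to each other when they are near a sphere bounding one of the
balls. Around each sphere, for each integer [q], choose an annulus of measure
less than [1/q]; two points on different sides of the sphere, one on the inner
side and outside of the annulus, are at a distance at least its width
([annulus_separates]). It remains to see that the orbits of the points of the
scrambled set spend little time in the annuli.

For almost every point this is an ergodic theorem ([overvisiting_null]), but a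
scrambled set may well consist of atypical points only. This is where the
freedom in the choice of the partitions is used: the set of the points that
visit some annulus too often is null and invariant, and the partitions are
modified on it by removing it from all the balls. The result is still refining
([core_refining]), because this null set can be recovered from the partitions
as the complement of the union of the modified balls. Two exceptional points
now always lie in the same atom, so that a scrambled set contains at most one of
them ([uncountable_nonexceptional]). For the other points, discarding the times
spent in the annuli decreases the upper density of a separating sequence by as
little as desired ([separation_transfer]), which for [(P_k)^+]-scrambled pairs
is compensated by starting from a density strictly between [eta] and [1].

Only a weak form of the ergodic theorem is needed: if [mu U < 1/q], then almost
every point visits [U] at most [(n + C)/q] times up to time [n], with [C]
depending on the point. The set where this fails is invariant, so otherwise it
has full measure, and almost every orbit can be tiled by blocks in which
the frequency of visits to [U] is at least [1/q]. Up to a small set the blocks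
have bounded length, and integrating gives [mu U >= 1/q] ([tiling_measure]). *)

(** * Frequency of visits in an ergodic system *)

Section visits.
Context {X : Type} (f : X -> X).

Definition visits (U : set X) (n : nat) (x : X) : nat :=
  (\sum_(i < n) (iter i f x \in U))%N.

Lemma visitsS U n x : visits U n.+1 x = ((x \in U) + visits U n (f x))%N.
Proof.
by rewrite /visits big_ord_recl /=; congr addn; apply: eq_bigr => i _; rewrite -iterSr.
Qed.

Lemma visitsD U m n x :
  visits U (m + n) x = (visits U m x + visits U n (iter m f x))%N.
Proof.
elim: m x => [|m IH] x; first by rewrite {2}/visits big_ord0.
by rewrite addSn !visitsS IH addnA -iterSr.
Qed.

Lemma le_visits U V n x : U `<=` V -> (visits U n x <= visits V n x)%N.
Proof.
move=> UV; apply: leq_sum => i _; case: (boolP (_ \in U)) => // /set_mem/UV.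
by move/mem_set => ->.
Qed.

(** A greedy tiling: as long as more than [M] steps remain, remove a block of
    length at most [M] in which the frequency of visits is at least [1/q]. *)
Lemma tiling (V : set X) (q M : nat) :
  (forall x, exists n, [/\ (0 < n)%N, (n <= M)%N & (n <= q * visits V n x)%N]) ->
  forall n x, (n <= q * visits V n x + M)%N.
Proof.
move=> block; elim/ltn_ind => n IH x.
have [nM|Mn] := leqP n M; first by rewrite (leq_trans nM)// leq_addl.
have [k [k0 kM kV]] := block x.
have kn : (k <= n)%N by rewrite (leq_trans kM)// ltnW.
have -> : visits V n x = (visits V k x + visits V (n - k) (iter k f x))%N.
  by rewrite -visitsD subnKC.
have := IH (n - k)%N ltac:(lia) (iter k f x); lia.
Qed.

(** Asking for an excess [C] that is unbounded, rather than for an upper density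
    larger than [1/q], makes the set strictly invariant and spares limits. *)
Definition overvisiting (U : set X) (q : nat) : set X :=
  [set x | forall C, exists n, (n + C <= q * visits U n x)%N].

(** Shifting the orbit by one changes the excess by at most [q + 1], a bounded
    amount. *)
Lemma overvisiting_invariant U q : f @^-1` overvisiting U q = overvisiting U q.
Proof.
apply/seteqP; split => x /= H C.
  have [n nC] := H (C + 1)%N; exists n.+1; rewrite visitsS; lia.
have [[|n] nC] := H (C + q + 1)%N; first by move: nC; rewrite /visits big_ord0; lia.
by exists n; move: nC; rewrite visitsS; case: (x \in U) => /=; lia.
Qed.

End visits.

Section ergodic.
Context {d : measure_display} {X : measurableType d} {R : realType}.
Context {mu : probability X R} {f : X -> X}.
Hypothesis fmu : measure_preserving mu f.

Lemma measurable_iter i : measurable_fun setT (iter i f).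
Proof.
elim: i => [|i IH]; first exact: measurable_id.
exact: (measurableT_comp fmu.1 IH).
Qed.

Lemma measure_iter_preimage i A : measurable A -> mu (iter i f @^-1` A) = mu A.
Proof.
move=> mA; elim: i => [//|i IH]; rewrite -IH -(fmu.2 (iter i f @^-1` A)).
  by congr (mu _); apply/seteqP; split => x; rewrite /= -iterS iterSr.
by rewrite -[_ @^-1` _]setTI; apply: measurable_iter.
Qed.

(** By induction on [n], splitting according to whether the first point is in [U],
    so that only preimages under [f] itself occur. *)
Lemma measurable_visits_ge U c n :
  measurable U -> measurable [set x | (c <= visits f U n x)%N].
Proof.
move=> mU; elim: n c => [|n IH] c.
  rewrite [X in measurable X](_ : _ = [set _ | (c <= 0)%N]).
    by case: (c <= 0)%N; [rewrite set_true|rewrite set_false].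
  by apply/seteqP; split => x; rewrite /= /visits big_ord0.
have mf A : measurable A -> measurable (f @^-1` A).
  by move=> mA; rewrite -[_ @^-1` _]setTI; apply: fmu.1 => //; exact: measurableT.
rewrite [X in measurable X](_ : _ =
    (U `&` (f @^-1` [set x | (c.-1 <= visits f U n x)%N])) `|`
    (f @^-1` [set x | (c <= visits f U n x)%N])).
  by apply: measurableU; [apply: measurableI => //|]; exact: mf.
apply/seteqP; split => x /=; rewrite visitsS.
  case: (boolP (x \in U)) => [/set_mem Ux|_] h; last by right.
  by left; split=> //; lia.
case=> [[/mem_set -> h]|h]; last by rewrite (leq_trans h)// leq_addl.
by rewrite /=; lia.
Qed.

Lemma measurable_visits_geM U q c n :
  measurable U -> measurable [set x | (c <= q * visits f U n x)%N].
Proof.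
move=> mU; have [->|q0] := posnP q.
  rewrite [X in measurable X](_ : _ = [set _ | (c <= 0)%N])//.
  by case: (c <= 0)%N; [rewrite set_true|rewrite set_false].
rewrite [X in measurable X](_ : _ =
    [set x | ((c + q.-1) %/ q <= visits f U n x)%N]).
  exact: measurable_visits_ge.
by apply/seteqP; split => x /=; nia.
Qed.

Lemma measurable_overvisiting U q :
  measurable U -> measurable (overvisiting f U q).
Proof.
move=> mU; rewrite [X in measurable X](_ : _ =
    \bigcap_C \bigcup_n [set x | (n + C <= q * visits f U n x)%N]).
  apply: bigcapT_measurable => C; apply: bigcupT_measurable => n.
  exact: measurable_visits_geM.
apply/seteqP; split => [x H C _|x H C]; first by have [n] := H C; exists n.
by have [n _] := H C Logic.I; exists n.
Qed.

Lemma visits_sum_indic V n x :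
  ((visits f V n x)%:R : R)%:E = (\sum_(i < n) (\1_(iter i f @^-1` V) x)%:E)%E.
Proof.
by rewrite /visits natr_sum -sumEFin; apply: eq_bigr => i _; rewrite indicE.
Qed.

Lemma measurable_visits V n : measurable V ->
  measurable_fun setT (fun x => ((visits f V n x)%:R : R)%:E).
Proof.
move=> mV; under eq_fun do rewrite visits_sum_indic.
apply: emeasurable_sum => i; apply/measurable_EFinP; apply: measurable_indic.
by rewrite -[_ @^-1` _]setTI; apply: measurable_iter.
Qed.

(** By invariance every time contributes [mu V] to the mean. *)
Lemma integral_visits V n : measurable V ->
  (\int[mu]_x ((visits f V n x)%:R : R)%:E = n%:R%:E * mu V)%E.
Proof.
move=> mV; under eq_integral do rewrite visits_sum_indic.
have miV i : measurable (iter i f @^-1` V).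
  by rewrite -[_ @^-1` _]setTI; apply: measurable_iter.
rewrite ge0_integral_sum//= => [|i]; last first.
  by apply/measurable_EFinP; apply: measurable_indic.
under eq_bigr do rewrite integral_indic// setIT.
rewrite (eq_bigr (fun=> mu V)) => [|i _]; last exact: measure_iter_preimage.
by rewrite sumr_const card_ord mule_natl.
Qed.

(** Integrating the tiling inequality gives [n <= q * n * mu V + M] for all [n];
    divide by [n] and let it go to infinity. *)
Lemma tiling_measure V q M : measurable V ->
  (forall x, exists n, [/\ (0 < n)%N, (n <= M)%N & (n <= q * visits f V n x)%N]) ->
  (1 <= q%:R%:E * mu V)%E.
Proof.
move=> mV /tiling tile.
have mVE := fineK (fin_num_measure mu V mV).
have mean n : n%:R <= q%:R * (n%:R * fine (mu V)) + M%:R :> R.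
  rewrite -lee_fin EFinD !EFinM mVE -integral_visits//.
  rewrite -ge0_integralZl//; last exact: measurable_visits.
  have cstE (r : R) : (r%:E = \int[mu]_x (cst r%:E) x)%E.
    by rewrite integral_cst// [X in (_ * X)%E]probability_setT mule1.
  rewrite [X in (X <= _)%E]cstE (cstE M%:R) -ge0_integralD//.
    apply: ge0_le_integral => //.
    - by move=> x _; rewrite lee_fin.
    - apply: emeasurable_funD => //.
      by apply: measurable_funeM; exact: measurable_visits.
    - by move=> x _ /=; rewrite -EFinM -EFinD lee_fin -natrM -natrD ler_nat.
  - by apply: measurable_funeM; exact: measurable_visits.
  - by move=> x _; rewrite lee_fin.
rewrite -mVE -EFinM lee_fin leNgt; apply/negP => lt1.
have [n Mn] : exists n : nat, M%:R / (1 - q%:R * fine (mu V)) < n%:R.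
  by exists (Num.bound (M%:R / (1 - q%:R * fine (mu V)))); apply: archi_boundP;
     rewrite divr_ge0// subr_ge0 ltW.
have := mean n; move: Mn; rewrite ltr_pdivrMr ?subr_gt0//.
set r := fine _; nra.
Qed.

End ergodic.

(** The maximal inequality behind the ergodic theorem. If the invariant set is
    not null it has full measure, so that almost every point has a block of some
    length in which the frequency of visits is at least [1/q]. Points without a
    block of length at most [M] form a set of small measure for large [M]; adding
    this set to [U] turns each of these points into a block of length one. *)
Theorem overvisiting_null {d} {X : measurableType d} {R : realType}
    (mu : probability X R) (f : X -> X) (U : set X) (q : nat) :
  ergodic mu f -> measurable U -> (0 < q)%N -> (q%:R%:E * mu U < 1)%E ->
  mu (overvisiting f U q) = 0%E.
Proof.
move=> [fmu ferg] mU q0 qU.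
have mE := measurable_overvisiting fmu _ q mU.
have [//|E1] := ferg _ mE (overvisiting_invariant f U q); exfalso.
pose B M := [set x | forall n, (0 < n <= M)%N -> (q * visits f U n x < n)%N].
have mB M : measurable (B M).
  rewrite (_ : B M = \bigcap_(n in [set n | (0 < n <= M)%N])
      ~` [set x | (n <= q * visits f U n x)%N]).
    apply: bigcap_measurableType => n _; apply: measurableC.
    exact: (measurable_visits_geM fmu).
  apply/seteqP; split => x /= H n.
    by move=> /H; rewrite ltnNge => /negP.
  by move=> /H /negP; rewrite -ltnNge.
have B0 : (mu (B M) @[M --> \oo] --> 0%E).
  have mBI := bigcapT_measurable mB.
  have <- : mu (\bigcap_M B M) = 0%E.
    apply/eqP; rewrite -measure_le0.
    suff : (mu (\bigcap_M B M) <= mu (~` overvisiting f U q))%E.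
      by rewrite probability_setC// E1 subee.
    apply: le_measure; rewrite ?inE//; first exact: measurableC.
    move=> x BIx Ex; have [[|n] nx] := Ex 1%N.
      by move: nx; rewrite /visits big_ord0 muln0.
    by have := BIx n.+1 Logic.I n.+1; move=> /(_ ltac:(lia)); lia.
  apply: nonincreasing_cvg_mu => //.
    by rewrite (le_lt_trans (probability_le1 _ _))// ltry.
  by move=> m n mn; apply/subsetPset => x Bx k /andP[k0 km]; apply: Bx; lia.
have [M qBU] : exists M, (q%:R%:E * mu (U `|` B M) < 1)%E.
  have muE A : measurable A -> mu A = (fine (mu A))%:E.
    by move=> mA; rewrite fineK// fin_num_measure.
  move: qU; rewrite (muE _ mU) -EFinM lte_fin => qU.
  move/fine_cvgP: B0 => [_ /cvgr_lt].
  move=> /(_ ((1 - q%:R * fine (mu U)) / q.+1%:R)) /=.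
  rewrite divr_gt0 ?subr_gt0// => /(_ isT)[M _ /(_ M (leqnn M)) /= BM].
  exists M; have mUB := measurableU _ _ mU (mB M).
  have : (mu (U `|` B M) <= mu U + mu (B M))%E by exact: measureU2.
  rewrite (muE _ mU) (muE _ (mB M)) (muE _ mUB) -EFinD -EFinM lee_fin lte_fin.
  move: BM; rewrite ltr_pdivlMr//.
  set u := fine (mu U); set b := fine (mu (B M)); set c := fine _ => bq cub.
  apply: (@le_lt_trans _ _ (q%:R * (u + b))); first by rewrite ler_wpM2l.
  have b0 : 0 <= b by rewrite fine_ge0.
  by move: bq; rewrite -natr1; nra.
suff : (1 <= q%:R%:E * mu (U `|` B M))%E by rewrite leNgt qBU.
apply: (tiling_measure fmu _ _ M.+1); first exact: measurableU.
(* [M.+1] and not [M] leaves room for blocks of length one when [M = 0]. *)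
move=> x; have [Bx|/existsNP[n /not_implyP[nM /negP]]] := pselect (B M x).
  exists 1%N; split => //; rewrite /visits big_ord1 /=.
  by rewrite (mem_set (or_intror Bx : (U `|` B M) x)) muln1.
rewrite -leqNgt => nq; exists n; split; [lia|lia|].
by rewrite (leq_trans nq)// leq_mul2l le_visits ?orbT.
Qed.

(** * Upper density *)

Section density.
Context {R : realType}.

Lemma limn_esup_geP (u : nat -> R) (a : R) :
  (a%:E <= limn_esup (fun n => (u n)%:E))%E <->
  forall e, 0 < e -> forall M, exists2 n, (M <= n)%N & a - e < u n.
Proof.
split=> [au e e0 M|H].
  have : ((a - e)%:E < ereal_sup [set (u n)%:E | n in [set n | (M <= n)%N]])%E.
    apply: (@lt_le_trans _ _ a%:E); first by rewrite lte_fin ltrBlDr ltrDl.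
    apply: (le_trans au); apply: ereal_inf_lbound.
    by exists [set n | (M <= n)%N] => //; exists M.
  by move=> /ereal_sup_gt[_ /= [n Mn <-]]; rewrite lte_fin => h; exists n.
apply: le_ereal_inf_tmp => _ /= [V [M _ MV] <-].
apply/lee_addgt0Pr => e e0; have [n Mn un] := H e e0 M.
apply: (@le_trans _ _ ((u n)%:E + e%:E)%E).
  by rewrite -EFinD lee_fin -lerBlDr ltW.
by apply: leeD => //; apply: ereal_sup_ubound; exists n => //; exact: MV.
Qed.

Definition counting (A : set nat) (N : nat) : nat := (\sum_(t < N) ((t : nat) \in A))%N.

Lemma countingS A N : counting A N.+1 = (counting A N + (N \in A))%N.
Proof. by rewrite /counting big_ord_recr. Qed.

Lemma counting_le A N : (counting A N <= N)%N.
Proof.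
elim: N => [|N IH]; first by rewrite /counting big_ord0.
by rewrite countingS; case: (N \in A) => /=; lia.
Qed.

Lemma counting_bounded (A : set nat) n N : (forall t, A t -> (t < n)%N) ->
  (counting A N <= n)%N.
Proof.
move=> An; elim: N => [|N IH]; first by rewrite /counting big_ord0.
rewrite countingS; case: (boolP (N \in A)) => [/set_mem/An|_]; last by rewrite addn0.
by have := counting_le A N; lia.
Qed.

Lemma le_counting A B N : A `<=` B -> (counting A N <= counting B N)%N.
Proof.
move=> AB; apply: leq_sum => i _; case: (boolP (_ \in A)) => // /set_mem/AB.
by move/mem_set => ->.
Qed.

Lemma counting_setU A B N :
  (counting (A `|` B) N <= counting A N + counting B N)%N.
Proof.
rewrite /counting -big_split /=; apply: leq_sum => i _.
by rewrite in_setU; do 2 case: (_ \in _).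
Qed.

(** Expresses the density through the range of the sequence only, so that
    sequences can be thinned out as sets of times. *)
Lemma card_increasing_le (m : nat -> nat) N : increasing_seq m ->
  #|` fset_set [set i | (m i <= N)%N] | = counting (range m) N.+1.
Proof.
move=> minc; have minj : injective m := increasing_seq_injective minc.
have mge i : (i <= m i)%N.
  elim: i => // i /leq_ltn_trans; apply.
  by have := minc i.+1 i; rewrite ltnn ltnNge => /negbT.
have fin n : finite_set [set i | (m i < n)%N].
  apply: (sub_finite_set (B := `I_n)); last exact: finite_II.
  by move=> i /= mi; rewrite (leq_ltn_trans _ mi).
suff H n : #|` fset_set [set i | (m i < n)%N] | = counting (range m) n.
  exact: (H N.+1).
elim: n => [|{}N IH].
  rewrite /counting big_ord0 (_ : [set _ | _] = set0) ?fset_set0 ?cardfs0//.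
  by apply/seteqP; split.
rewrite countingS -IH; case: (boolP (_ \in range m)) => [/set_mem[i _ mi]|Nm].
  rewrite (_ : [set j | (m j < N.+1)%N] = i |` [set j | (m j < N)%N]).
    rewrite fset_setU1// cardfsU1 in_fset_set// memNset /= ?mi ?ltnn//.
    by rewrite addnC.
  apply/seteqP; split => j /=; last by case=> [->|/ltnW//]; rewrite mi.
  rewrite ltnS leq_eqVlt => /orP[/eqP mj|]; last by right.
  by left; apply: minj; rewrite mj.
rewrite addn0; congr (#|` fset_set _|); apply/seteqP; split => j /=; last first.
  by move=> /ltnW.
rewrite ltnS leq_eqVlt => /orP[/eqP mj|//]; exfalso.
by move/negP: Nm; apply; apply/mem_set; exists j.
Qed.

Lemma enum_infinite (G : set nat) : (forall n, exists2 t, G t & (n <= t)%N) ->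
  exists2 m : nat -> nat, increasing_seq m & range m = G.
Proof.
move=> Ginf.
have exG n : exists t, `[< G t >] && (n <= t)%N.
  by have [t Gt nt] := Ginf n; exists t; rewrite nt asboolT.
pose nxt n := ex_minn (exG n).
have nxtP n : [/\ G (nxt n), (n <= nxt n)%N &
    forall t, G t -> (n <= t)%N -> (nxt n <= t)%N].
  rewrite /nxt; case: ex_minnP => t /andP[/asboolP Gt nt] tmin; split => // s Gs ns.
  by apply: tmin; rewrite ns asboolT.
pose fix m i := if i is j.+1 then nxt (m j).+1 else nxt 0%N.
have minc i : (m i < m i.+1)%N by have [] := nxtP (m i).+1.
have mG i : G (m i) by case: i => [|i]; [have [] := nxtP 0%N|have [] := nxtP (m i).+1].
exists m; first by apply/increasing_seqP.
apply/seteqP; split => [_ [i _ <-]//|t Gt]; apply: contrapT => nt.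
have mt i : (m i < t)%N.
  have mit : m i <> t by move=> e; apply: nt; exists i.
  suff : (m i <= t)%N by move: mit; lia.
  elim: i mit => [|i IH] _; first by have [_ _] := nxtP 0%N; apply.
  have [_ _] := nxtP (m i).+1; apply => //.
  have mit : m i <> t by move=> e; apply: nt; exists i.
  by have := IH mit; move: mit; lia.
have mge i : (i <= m i)%N by elim: i => // i; have := minc i; lia.
by have := mt t; have := mge t; lia.
Qed.

Lemma upper_density_geP (m : nat -> nat) (a : R) : increasing_seq m ->
  (a%:E <= upper_density R m)%E <->
  forall e, 0 < e -> forall M, exists2 n, (M <= n)%N &
    a - e < (counting (range m) n.+1)%:R / n%:R.
Proof.
move=> minc; rewrite -limn_esup_geP.
have -> // : upper_density R m =
  limn_esup (fun n => ((counting (range m) n.+1)%:R / n%:R : R)%:E).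
by congr limn_esup; apply/funext => n; rewrite card_increasing_le.
Qed.

(** Removing from a sequence a set of times of upper density at most [a - b]
    costs at most [a - b] in upper density. What remains has positive upper density,
    hence is infinite and can be enumerated again. *)
Lemma upper_density_thin (m : nat -> nat) (B : set nat) (a b C : R) :
  positive_increasing m -> b < a -> 0 < b ->
  (forall n, (counting B n)%:R <= (a - b) * n%:R + C) ->
  (a%:E <= upper_density R m)%E ->
  exists m', [/\ positive_increasing m', (b%:E <= upper_density R m')%E &
    range m' = range m `\` B].
Proof.
move=> [minc m0] ba b0 HB /(upper_density_geP _ _ minc) am.
pose G := range m `\` B.
have Gbig e : 0 < e -> forall M, exists2 n, (M <= n)%N &
    b - e < (counting G n.+1)%:R / n%:R.
  move=> e0 M.
  have e20 : 0 < e / 2 by rewrite divr_gt0.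
  (* [n] is so large that the constants [a - b] and [C] are below [n * e / 2]. *)
  have [n Mn an] := am _ e20 (maxn M.+1 (Num.bound ((`|a - b + C|) / (e / 2)))).
  exists n; first lia.
  have n0 : (0 : R) < n%:R by rewrite ltr0n; lia.
  move: an; rewrite !ltr_pdivlMr// => an.
  have nC : `|a - b + C| < (e / 2) * n%:R.
    rewrite mulrC -ltr_pdivrMr//.
    apply: lt_le_trans (_ : (Num.bound (`|a - b + C| / (e / 2)))%:R <= _).
      by apply: archi_boundP; rewrite divr_ge0// ltW.
    by rewrite ler_nat; lia.
  have : (counting (range m) n.+1)%:R <= (counting G n.+1)%:R + (counting B n.+1)%:R :> R.
    rewrite -natrD ler_nat; apply: leq_trans (counting_setU _ _ _).
    by apply: le_counting => t mt; have [Bt|nBt] := pselect (B t); [right|left].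
  have := HB n.+1; have := ler_norm (a - b + C); rewrite -natr1.
  by move: nC an; set x := `|_|; lra.
have Ginf n : exists2 t, G t & (n <= t)%N.
  apply: contrapT => nG.
  have Gn t : G t -> (t < n)%N.
    by move=> Gt; rewrite ltnNge; apply/negP => nt; apply: nG; exists t.
  have b20 : 0 < b / 2 by rewrite divr_gt0.
  have [k Mk] := Gbig _ b20 (Num.bound (n%:R / (b / 2))).+1.
  have k0 : (0 : R) < k%:R by rewrite ltr0n; lia.
  have : n%:R / (b / 2) < k%:R.
    apply: lt_le_trans (_ : (Num.bound (n%:R / (b / 2)))%:R <= _).
      by apply: archi_boundP; rewrite divr_ge0// ltW.
    by rewrite ler_nat ltnW.
  rewrite ltr_pdivlMr// ltr_pdivrMr// => nk kG.
  have : (counting G k.+1)%:R <= n%:R :> R by rewrite ler_nat counting_bounded.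
  by move: nk kG; lra.
have [m' m'inc m'G] := enum_infinite _ Ginf.
exists m'; split => //; last by rewrite upper_density_geP// m'G.
split => // i; have : G (m' i) by rewrite -m'G; exists i.
by case=> -[j _ <-].
Qed.

End density.

(** * The completed sigma-algebra *)

Section completion.
Context {d : measure_display} {X : measurableType d} {R : realType}.
Variable mu : probability X R.

Lemma completed_measurable A : measurable A -> completed_algebra_gen mu A.
Proof.
by move=> mA; exists A => //; exists set0; [exact: negligible_set0|rewrite setU0].
Qed.

(** Equality off a null measurable set is visibly stable under complements and
    countable unions. *)
Lemma completedP A : completed_algebra_gen mu A <->
  exists B M, [/\ measurable B, measurable M, mu M = 0%E & A `\` M = B `\` M].
Proof.
split=> [[B mB [N [M [mM M0 NM]] <-]]|[B [M [mB mM M0 AB]]]].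
  exists B, M; split => //; apply/seteqP; split=> x [].
    by case=> // /NM.
  by move=> Bx nM; split => //; left.
exists (B `\` M); first exact: measurableD.
exists (A `&` M); first by exists M; split => // x [].
by rewrite -AB setUC setUIDK.
Qed.

Lemma completed_complete :
  complete_sub_sigma_algebra mu (completed_algebra_gen mu).
Proof.
split; [split| |] => //.
- exact: completed_measurable.
- move=> A /completedP[B [M [mB mM M0 AB]]]; apply/completedP.
  exists (~` B), M; split => //; first exact: measurableC.
  move/seteqP: AB => [AB BA]; rewrite setTD; apply/seteqP; split => x [nAx nMx].
    by split => // Bx; apply: nAx; have [] := BA x (conj Bx nMx).
  by split => // Bx; apply: nAx; have [] := AB x (conj Bx nMx).
- move=> A cA.
  have cA' n : exists BM : set X * set X, [/\ measurable BM.1, measurable BM.2,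
      mu BM.2 = 0%E & A n `\` BM.2 = BM.1 `\` BM.2].
    by have /completedP[B [M H]] := cA n; exists (B, M).
  have [BM H] := choice cA'; apply/completedP.
  exists (\bigcup_n (BM n).1), (\bigcup_n (BM n).2); split.
  + by apply: bigcupT_measurable => n; have [] := H n.
  + by apply: bigcupT_measurable => n; have [] := H n.
  + apply: measure_negligible.
      by apply: bigcupT_measurable => n; have [] := H n.
    by apply: negligible_bigcup => n; have [_ mM M0 _] := H n; exists (BM n).2; split.
  + have AB n : forall x, ~ (BM n).2 x -> A n x <-> (BM n).1 x.
      have [_ _ _ /seteqP[AB BA]] := H n.
      move=> x nM; split => Hx; first by have [] := AB x (conj Hx nM).
      by have [] := BA x (conj Hx nM).
    apply/seteqP; split => x [[n _ Hx] nMx].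
      by split => //; exists n => //; apply/AB => // Mx; apply: nMx; exists n.
    by split => //; exists n => //; apply/AB => // Mx; apply: nMx; exists n.
- move=> N M _ negN MN; apply/completedP.
  have [W [mW W0 NW]] := negN; exists set0, W; split => //.
  rewrite set0D; apply/seteqP; split => x // -[Mx []].
  exact/NW/MN.
Qed.

End completion.

(** * Partitions generated by a sequence of sets *)

Section cells.
Context {d : measure_display} {X : measurableType d} (phi : nat -> set X).

(** Atom of [x] in the partition generated by the first [k] sets [phi i]. *)
Definition cell (k : nat) (x : X) : set X :=
  [set y | forall i, (i < k)%N -> phi i x <-> phi i y].

Definition cells (k : nat) : set (set X) := range (cell k).

Lemma cell_refl k x : cell k x x.
Proof. by []. Qed.

Lemma cell_eq k x y : cell k x y -> cell k x = cell k y.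
Proof.
move=> xy; apply/seteqP; split => z xz i ik.
  exact: iff_trans (iff_sym (xy i ik)) (xz i ik).
exact: iff_trans (xy i ik) (xz i ik).
Qed.

Lemma cells_partition k : partition (cells k) id [set: X].
Proof.
split; first by apply/seteqP; split => // x _; exists (cell k x); [exists x|].
  move=> _ _ [x _ <-] [y _ <-] [z [xz yz]].
  by rewrite (cell_eq _ _ _ xz) (cell_eq _ _ _ yz).
by move=> _ [x _ <-]; exists x; exact: cell_refl.
Qed.

Lemma cells_finite k : finite_set (cells k).
Proof.
pose g (v : {ffun 'I_k -> bool}) : set X := [set y | forall i, v i <-> phi i y].
apply: (sub_finite_set (B := range g)); last exact/finite_image/finite_finset.
move=> _ [x _ <-]; exists [ffun i : 'I_k => `[< phi i x >]] => //.
apply/seteqP; split => y H i.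
  move=> ik; have := H (Ordinal ik); rewrite ffunE /= => h.
  by split => [/asboolP/h//|/h/asboolP].
rewrite ffunE; split => [/asboolP/(H i (ltn_ord i))//|].
by move/(H i (ltn_ord i))/asboolP.
Qed.

Lemma cells_refine k : refines (cells k.+1) (cells k).
Proof.
move=> _ [x _ <-]; exists (cell k x); first by exists x.
by move=> y xy i ik; apply: xy; rewrite ltnW.
Qed.

Lemma same_cell k x y : same_atom (cells k) x y -> cell k x y.
Proof.
move=> [_ [[z _ <-] zx zy]] i ik.
exact: iff_trans (iff_sym (zx i ik)) (zy i ik).
Qed.

Lemma different_cells k x y : different_atoms (cells k) x y -> ~ cell k x y.
Proof.
move=> [_ [_ [[z _ <-] [w _ <-] zw zx wy]]] xy; apply: zw.
by rewrite (cell_eq _ _ _ zx) (cell_eq _ _ _ wy) (cell_eq _ _ _ xy).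
Qed.

Lemma bigcup_cells i : phi i = \bigcup_(A in cells i.+1 `&` [set A | A `<=` phi i]) A.
Proof.
apply/seteqP; split => [x phix|x [A [_ Aphi]]]; last exact: Aphi.
exists (cell i.+1 x); last exact: cell_refl.
by split; [exists x|move=> y /(_ i (ltnSn i)) <-].
Qed.

End cells.

Section refining.
Context {d : measure_display} {X : measurableType d} {R : realType}.
Variables (mu : probability X R) (phi : nat -> set X).
Hypothesis mphi : forall i, measurable (phi i).

Lemma measurable_cell k x : measurable (cell phi k x).
Proof.
rewrite (_ : cell phi k x =
    \bigcap_(i in `I_k) (if `[< phi i x >] then phi i else ~` phi i)).
  apply: bigcap_measurableType => i _.
  by case: asboolP => _ //; exact: measurableC.
apply/seteqP; split => y H i ik; have := H i ik.
  by case: asboolP => // phix h; [exact/h|move=> /h].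
by case: asboolP => phix h; split => //.
Qed.

(** A null set has all its subsets in a complete sub-sigma-algebra only if it
    belongs to it. For null sets disjoint from [N] this follows from [gen],
    applied to a measurable null cover; and [N] belongs to it because it is the
    complement of the union of the [phi i]. *)
Lemma cells_refining (N := ~` \bigcup_i phi i) :
  mu.-negligible N ->
  (forall A, measurable A -> forall G, sigma_algebra [set: X] G ->
     (forall i, G (phi i)) -> G (A `\` N)) ->
  refining_sequence mu (cells phi).
Proof.
move=> negN gen; split.
- move=> k; split; [exact: cells_finite| |exact: cells_partition].
  by move=> _ [x _ <-]; apply: completed_measurable; exact: measurable_cell.
- exact: cells_refine.
have Pc : \bigcup_k cells phi k `<=` completed_algebra_gen mu.
  by move=> _ [k _ [x _ <-]]; apply: completed_measurable; exact: measurable_cell.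
apply/seteqP; split; first by apply: smallest_sub => //; exact: completed_complete.
move=> _ [A mA [Z [W [mW W0 ZW]] <-]] G [[sG Gc Gneg] PG].
have GE B : @measurable _ (g_sigma_algebraType G) B = G B.
  by rewrite -[in RHS](sigma_algebra_id sG).
have Gphi i : G (phi i).
  rewrite (bigcup_cells phi i) -GE; apply: fin_bigcup_measurable.
    exact/finite_setIl/cells_finite.
  by move=> C [PC _]; rewrite GE; apply: PG; exists i.+1.
have GN : G N.
  by rewrite -GE; apply: measurableC; apply: bigcupT_measurable => i; rewrite GE.
have GD B : measurable B -> G (B `\` N) by move=> mB; exact: gen.
have -> : A `|` Z = (A `\` N) `|` ((A `&` N) `|` (Z `\` N) `|` (Z `&` N)).
  apply/seteqP; split => x /=; have [Nx|nNx] := pselect (N x); tauto.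
rewrite -GE; apply: measurableU; first by rewrite GE; exact: GD.
apply: measurableU; last by rewrite GE; exact: Gneg GN negN (@subIsetr _ _ _).
apply: measurableU; first by rewrite GE; exact: Gneg GN negN (@subIsetr _ _ _).
rewrite GE; apply: (Gneg (W `\` N)); first exact: GD.
  by exists W; split => //; exact: subDsetl.
by move=> x [/ZW Wx nN].
Qed.

End refining.

(** * Balls and thin annuli in a compact metric space *)

Section balls.
Context {R : realType} {X : pointedMetricType R}.
Local Notation T := (g_sigma_algebraType (@open X)).

Definition mball (c : X) (r : R) : set X := [set y | mdist c y < r].

Definition annulus (c : X) (r e : R) : set X := mball c r `\` mball c (r - e).

Lemma open_mball c r : open (mball c r).
Proof.
rewrite openE => y /= yr; apply/metricType_numDomainType.nbhs_mdistP.
exists (r - mdist c y); first by rewrite /= subr_gt0.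
move=> z /= yz; rewrite /mball /=.
by apply: le_lt_trans (metric_triangle c y z) _; rewrite -ltrBrDl.
Qed.

Lemma measurable_mball c r : @measurable _ T (mball c r).
Proof. by apply: sub_sigma_algebra; exact: open_mball. Qed.

Lemma measurable_annulus c r e : @measurable _ T (annulus c r e).
Proof. by apply: measurableD; exact: measurable_mball. Qed.

(** The annuli [r - s <= d(c, y) < r] decrease to the empty set as [s] goes to [0],
    so no sphere needs to be null. *)
Lemma thin_annulus (mu : probability T R) c r (e : R) : 0 < e ->
  exists2 s, 0 < s & (mu (annulus c r s) < e%:E)%E.
Proof.
move=> e0.
have mA (n : nat) : @measurable _ T (annulus c r n.+1%:R^-1) by exact: measurable_annulus.
have cap0 : \bigcap_n annulus c r n.+1%:R^-1 = set0.
  apply/seteqP; split => // y H; have [yr _] := H 0%N Logic.I.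
  move: yr; rewrite /mball /= -subr_gt0 => yr.
  have [_] := H (Num.bound (r - mdist c y)^-1) Logic.I; apply.
  rewrite /mball /= ltrBrDr -ltrBrDl invf_plt ?posrE//.
  apply: lt_trans (archi_boundP _) _; first by rewrite invr_ge0 ltW.
  by rewrite ltr_nat.
have : (mu (annulus c r n.+1%:R^-1) @[n --> \oo] --> mu set0).
  rewrite -cap0; apply: nonincreasing_cvg_mu => //.
  - by rewrite (le_lt_trans (probability_le1 _ _))// ltry.
  - exact: bigcapT_measurable.
  - move=> m n mn; apply/subsetPset => y [yr nyr]; split => // ym.
    apply: nyr; rewrite /mball /=; apply: (lt_le_trans ym).
    by rewrite lerD2l lerN2 lef_pV2 ?posrE// ler_nat.
rewrite measure0 => /fine_cvgP[_ /cvgr_lt] /(_ _ e0)[n _ /(_ n (leqnn n)) /= H].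
exists n.+1%:R^-1; first by rewrite invr_gt0.
by rewrite -(fineK (fin_num_measure mu _ (mA n))) lte_fin.
Qed.

(** The distances from [c] to the two points differ by at least [s]. *)
Lemma annulus_separates c r s x y :
  mball c r x -> ~ mball c r y -> ~ annulus c r s x -> s <= mdist x y.
Proof.
move=> xr yr nA.
have xs : mball c (r - s) x by apply: contrapT => h; apply: nA.
move: xs yr; rewrite /mball /= => xs /negP; rewrite -leNgt => yr.
by have := metric_triangle c x y; lra.
Qed.

(** A base of balls, in a uniform form: at every scale, finitely many of them
    cover the space. *)
Definition fine_balls (c : nat -> X) (r : nat -> R) : Prop :=
  forall e, 0 < e -> exists k, forall x, exists2 i, (i < k)%N &
    mball (c i) (r i) x /\ r i <= e.

Lemma compact_fine_balls : compact [set: X] -> exists c r, fine_balls c r.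
Proof.
rewrite compact_cover => cX.
have cover j : exists s : seq X, forall x, exists2 z, z \in s & mball z j.+1%:R^-1 x.
  have [||D _ DX] := cX X setT (fun z => mball z j.+1%:R^-1).
  - by move=> z _; exact: open_mball.
  - by move=> x _; exists x => //; rewrite /mball /= mdistxx.
  exists D => x; have [z zD zx] := DX x Logic.I; by exists z.
have [F HF] := choice cover.
pose dec (i : nat) : nat * nat := odflt (0, 0)%N (choice.unpickle i).
(* The ball of index [(j, l)] has radius [1/(j+1)] and is centered at the [l]-th
   element of a finite net [F j]. *)
exists (fun i => nth point (F (dec i).1) (dec i).2), (fun i => (dec i).1.+1%:R^-1).
move=> e e0; pose j := Num.bound e^-1.
exists (\max_(l < size (F j)) (choice.pickle (j, (l : nat))).+1) => x.
have [z zF zx] := HF j x.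
have zs : (index z (F j) < size (F j))%N by rewrite index_mem.
exists (choice.pickle (j, index z (F j))).
  exact: (leq_bigmax (Ordinal zs)).
rewrite /dec choice.pickleK /= nth_index//; split => //.
rewrite invf_ple ?posrE//; apply: le_trans (ltW (archi_boundP _)) _.
  by rewrite invr_ge0 ltW.
by rewrite ler_nat.
Qed.

Lemma open_bigcup_fine_balls c r (U : set X) : fine_balls c r -> open U ->
  U = \bigcup_(i in [set i | mball (c i) (r i) `<=` U]) mball (c i) (r i).
Proof.
move=> fb Uo; apply/seteqP; split => [x Ux|x [i]]; last exact.
have /metricType_numDomainType.nbhs_mdistP[e /= e0 eU] : nbhs x U.
  exact: open_nbhs_nbhs.
have e20 : 0 < e / 2 by rewrite divr_gt0.
have [k /(_ x)[i _ [xi ri]]] := fb _ e20.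
exists i => // y yi; apply: eU => /=.
apply: (le_lt_trans (metric_triangle x (c i) y)).
by move: xi yi; rewrite /mball /= (metric_sym x); lra.
Qed.

End balls.

(** * Transfer of scrambled pairs *)

Lemma positive_lower_bound {R : realType} (w : nat -> R) k :
  (forall i, 0 < w i) -> exists2 s, 0 < s & forall i, (i < k)%N -> s <= w i.
Proof.
move=> w0; elim: k => [|k [s s0 sw]]; first by exists 1.
exists (Num.min s (w k)); first by rewrite lt_min s0 w0.
move=> i; rewrite ltnS leq_eqVlt ge_min => /orP[/eqP->|/sw->//].
by rewrite lexx orbT.
Qed.

Lemma uncountable_setD {X : Type} (S N : set X) : ~ countable S ->
  (forall x y, S x -> S y -> N x -> N y -> x = y) -> ~ countable (S `\` N).
Proof.
move=> Sunc N1 SDc; apply: Sunc.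
have SIc : countable (S `&` N).
  have [[z [Sz Nz]]|noN] := pselect (exists z, S z /\ N z).
    apply: (sub_countable (B := [set z])); last exact: countable1.
    by apply: subset_card_le => x [Sx Nx]; exact: N1.
  rewrite (_ : S `&` N = set0) ?countable0//.
  by apply/seteqP; split => // x SNx; apply: noN; exists x.
rewrite (_ : S = \bigcup_(b in [set: bool]) (if b then S `&` N else S `\` N)).
  by apply: bigcup_countable => // -[].
apply/seteqP; split => [x Sx|x [[] _ []]//].
by have [Nx|nNx] := pselect (N x); [exists true|exists false].
Qed.

Section transfer.
Context {R : realType} {X : pointedMetricType R}.
Local Notation T := (g_sigma_algebraType (@open X)).
Variables (f : X -> X) (mu : probability T R).
Variables (c : nat -> X) (r : nat -> R) (w : nat -> nat -> R).
Hypothesis balls : fine_balls c r.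
Hypothesis f_ergodic : ergodic (X := T) mu f.
Hypothesis w_gt0 : forall i q, 0 < w i q.
Hypothesis w_thin : forall i q,
  (mu (annulus (c i) (r i) (w i q)) < (q.+1%:R^-1)%:E)%E.

Definition exceptional : set X :=
  \bigcup_i \bigcup_q overvisiting f (annulus (c i) (r i) (w i q)) q.+1.

Definition core i : set X := mball (c i) (r i) `\` exceptional.

Local Notation partitions := (cells (X := T) core).

Lemma measurable_exceptional : @measurable _ T exceptional.
Proof.
apply: bigcupT_measurable => i; apply: bigcupT_measurable => q.
apply: (measurable_overvisiting f_ergodic.1).
exact: measurable_annulus.
Qed.

Lemma exceptional_null : mu exceptional = 0%E.
Proof.
apply: measure_negligible; first exact: measurable_exceptional.
apply: negligible_bigcup => i; apply: negligible_bigcup => q.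
have mA := measurable_annulus (c i) (r i) (w i q).
exists (overvisiting f (annulus (c i) (r i) (w i q)) q.+1); split => //.
  exact: (measurable_overvisiting f_ergodic.1).
apply: (overvisiting_null (X := T)) => //.
have := w_thin i q; rewrite -(fineK (fin_num_measure mu _ mA)) -EFinM !lte_fin.
by rewrite -ltr_pdivlMl// mulr1.
Qed.

Lemma exceptional_iter t x : exceptional (iter t f x) = exceptional x.
Proof.
elim: t => //= t <-; apply/propext; rewrite /exceptional.
split=> -[i _ [q _ H]]; exists i => //; exists q => //.
  by rewrite -overvisiting_invariant.
by rewrite -overvisiting_invariant in H.
Qed.

Lemma core_cover : ~` (\bigcup_i core i) = exceptional.
Proof.
apply/seteqP; split => [x nx|x Ex [i _ []//]].
apply: contrapT => nEx; apply: nx; have [k /(_ x)[i _ [xi _]]] := balls _ (@ltr01 R).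
by exists i.
Qed.

(** Off the null set [exceptional], the sets [core i] are a base of the topology,
    hence generate the Borel sets. *)
Lemma core_refining : refining_sequence (X := T) mu partitions.
Proof.
have mE := measurable_exceptional.
apply: cells_refining.
- by move=> i; apply: measurableD => //; exact: measurable_mball.
- by rewrite core_cover; apply/negligibleP => //; exact: exceptional_null.
rewrite core_cover => A mA G sG Gcore.
have GE (B : set X) : @measurable _ (g_sigma_algebraType G) B = G B.
  by rewrite -[in RHS](sigma_algebra_id sG).
have GN : G (~` exceptional).
  rewrite -core_cover setCK -GE.
  by apply: bigcupT_measurable => i; rewrite GE.
pose H := [set B : set X | G (B `\` exceptional)].
suff : <<s [set: X], @open X >> `<=` H by apply.
apply: smallest_sub; first split.
- by rewrite /H /= set0D -GE; exact: measurable0.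
- move=> B; rewrite /H /= -!GE => GB.
  rewrite (_ : _ `\` _ = ~` exceptional `\` (B `\` exceptional)).
    by apply: measurableD => //; rewrite GE.
  by apply/seteqP; split => x /=; tauto.
- move=> B HB; rewrite /H /= setD_bigcupl -GE.
  by apply: bigcupT_measurable => n; rewrite GE; exact: HB.
move=> U /(open_bigcup_fine_balls _ _ _ balls) ->.
rewrite /H /= setD_bigcupl -GE; apply: bigcup_measurable => i _.
by rewrite GE; exact: Gcore.
Qed.

(** The orbits stay in [exceptional], which is disjoint from all the [core i]. *)
Lemma exceptional_not_separated m k x y : exceptional x -> exceptional y ->
  ~ mt_separated_along (X := T) f partitions m k x y.
Proof.
move=> Ex Ey /(_ 0%N)/different_cells; apply=> i _.
by split => -[_ []]; rewrite exceptional_iter.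
Qed.

(** The atoms that meet the complement of [exceptional] have a diameter that
    tends to [0], because such a point is in some small [core j]. *)
Lemma proximal_transfer x y : ~ exceptional x -> ~ exceptional y ->
  mt_proximal (X := T) (R := R) f partitions x y -> top_proximal f x y.
Proof.
move=> nEx nEy [n [ninc n1 same]]; exists n; split => //.
apply/cvgrPdist_lt => e e0; have e20 : 0 < e / 3 by rewrite divr_gt0.
have [k kP] := balls _ e20.
near=> i.
have sa : same_atom (X := T) (partitions k) (iter (n i) f x) (iter (n i) f y).
  by near: i; exact: same.
have xy := same_cell _ _ _ _ sa.
have [j jk [xj rj]] := kP (iter (n i) f x).
have [yj _] : core j (iter (n i) f y).
  by apply/(xy j jk); split => //; rewrite exceptional_iter.
rewrite distrC subr0 ger0_norm ?mdist_ge0//.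
apply: (le_lt_trans (metric_triangle _ (c j) _)).
by move: xj yj; rewrite /mball /= (metric_sym _ (c j)); lra.
Unshelve. all: by end_near. Qed.

Definition bad_times k q x : set nat :=
  [set t | exists2 i, (i < k)%N & annulus (c i) (r i) (w i q) (iter t f x)].

Lemma counting_bad_times k q x : ~ exceptional x ->
  exists C, forall n, (q.+1 * counting (bad_times k q x) n <= k * n + C)%N.
Proof.
move=> nEx; elim: k => [|k [C IH]].
  exists 0%N => n; rewrite [counting _ _](_ : _ = 0%N) ?muln0//.
  rewrite /counting big1// => t _; rewrite memNset//.
  by case.
have [C' HC'] : exists C', forall n,
    (q.+1 * visits f (annulus (c k) (r k) (w k q)) n x < n + C')%N.
  apply: contrapT => /forallNP H; apply: nEx; exists k => //; exists q => // C'.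
  by have /existsNP[n /negP] := H C'; rewrite -leqNgt => nC; exists n.
exists (C + C')%N => n; have := IH n; have := HC' n.
have : (counting (bad_times k.+1 q x) n <=
    counting (bad_times k q x) n + visits f (annulus (c k) (r k) (w k q)) n x)%N.
  apply: leq_trans (counting_setU _ [set t | annulus (c k) (r k) (w k q) (iter t f x)] _).
  apply: le_counting => t [i]; rewrite ltnS leq_eqVlt => /orP[/eqP->|ik] ti; first by right.
  by left; exists i.
set a := counting _ n; set b := counting _ n; set v := visits _ _ _ _; nia.
Qed.

(** The two orbits spend a proportion of time at most [2k/(q+1) <= a - b] in the
    first [k] annuli. At every other time at which they are in different atoms, their
    distance is at least the smallest width of these annuli, a bound that depends
    neither on the points nor on the sequence. *)
Lemma separation_transfer k (a b : R) : 0 < b -> b < a -> exists2 s, 0 < s &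
  forall x y, ~ exceptional x -> ~ exceptional y -> forall m,
    positive_increasing m -> (a%:E <= upper_density R m)%E ->
    mt_separated_along (X := T) f partitions m k x y ->
    exists m', [/\ positive_increasing m', (b%:E <= upper_density R m')%E &
      top_separated_along f m' s x y].
Proof.
move=> b0 ba; pose q := Num.bound ((2 * k)%:R / (a - b)).
have [s s0 sw] := positive_lower_bound (w ^~ q) k (w_gt0 ^~ q).
exists s => // x y nEx nEy m minc ma sep.
have [C HC] := counting_bad_times k q x nEx.
have [D HD] := counting_bad_times k q y nEy.
have bad_few n : (counting (bad_times k q x `|` bad_times k q y) n)%:R <=
    (a - b) * n%:R + (C + D)%:R.
  have qk : (2 * k)%:R <= q.+1%:R * (a - b).
    rewrite -ler_pdivrMr ?subr_gt0//; apply: le_trans (ltW (archi_boundP _)) _.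
      by rewrite divr_ge0// subr_ge0 ltW.
    by rewrite ler_nat.
  have nk : (q.+1 * counting (bad_times k q x `|` bad_times k q y) n
      <= 2 * k * n + (C + D))%N.
    have := counting_setU (bad_times k q x) (bad_times k q y) n.
    by have := HC n; have := HD n; nia.
  rewrite -(ler_pM2l (ltr0Sn R q)).
  move: nk; rewrite -(ler_nat R) natrM natrD natrM => /le_trans; apply.
  rewrite mulrDr mulrA lerD ?ler_wpM2r// ler_peMl//.
  by rewrite ler1n.
have [m' [m'inc m'b m'm]] := upper_density_thin m _ _ _ _ minc ba b0 bad_few ma.
exists m'; split => // j.
have [[i _ mi] /not_orP[nbx nby]] :
    (range m `\` (bad_times k q x `|` bad_times k q y)) (m' j).
  by rewrite -m'm; exists j.
have /different_cells/existsNP[l /not_implyP[lk]] := sep i.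
rewrite mi => xyl; apply: (le_trans (sw l lk)).
have nAx : ~ annulus (c l) (r l) (w l q) (iter (m' j) f x).
  by move=> h; apply: nbx; exists l.
have nAy : ~ annulus (c l) (r l) (w l q) (iter (m' j) f y).
  by move=> h; apply: nby; exists l.
have coreE z : ~ exceptional z ->
    core l (iter (m' j) f z) <-> mball (c l) (r l) (iter (m' j) f z).
  by move=> nEz; split => [[]//|]; split => //; rewrite exceptional_iter.
have := coreE _ nEx; have := coreE _ nEy.
have [Bx|nBx] := pselect (mball (c l) (r l) (iter (m' j) f x));
  have [By|nBy] := pselect (mball (c l) (r l) (iter (m' j) f y)) => ty tx.
- by exfalso; tauto.
- exact: annulus_separates nAx.
- by rewrite metric_sym; exact: annulus_separates nAy.
- by exfalso; tauto.
Qed.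

Lemma scrambled_transfer S : mt_scrambled (X := T) (R := R) f partitions S ->
  DC2_scrambled f (S `\` exceptional).
Proof.
move=> Sscr x y [Sx nEx] [Sy nEy] xy.
have [prox [m [k [minc m0 msep]]]] := Sscr x y Sx Sy xy.
split; first exact: proximal_transfer.
have [a a0 am] : exists2 a : R, 0 < a & (a%:E <= upper_density R m)%E.
  move: m0; case: (upper_density R m) => [a||] //.
    by rewrite lte_fin => a0; exists a.
  by exists 1 => //; exact: leey.
have [||s s0 H] := separation_transfer k a (a / 2) _ _; [lra|lra|].
have [m' [m'inc m'a m's]] := H x y nEx nEy m minc am msep.
by exists m', s; split => //; apply: lt_le_trans m'a; rewrite lte_fin; lra.
Qed.

Lemma plus_scrambled_transfer S :
  mt_plus_scrambled (X := T) (R := R) f partitions S ->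
  DC32_scrambled f (S `\` exceptional).
Proof.
move=> Sscr x y [Sx nEx] [Sy nEy] xy.
have [prox sep] := Sscr x y Sx Sy xy; split; first exact: proximal_transfer.
move=> eta eta01; have [m [k [minc ma msep]]] := sep ((1 + eta) / 2) ltac:(lra).
have [||s s0 H] := separation_transfer k ((1 + eta) / 2) eta _ _; [lra|lra|].
by have [m' [? ? ?]] := H x y nEx nEy m minc ma msep; exists m', s.
Qed.

(** A separated pair does not consist of two exceptional points, so at most one
    point of [S] is exceptional. *)
Lemma uncountable_nonexceptional S : ~ countable S ->
  scrambled_for (fun x y => exists m k,
    mt_separated_along (X := T) f partitions m k x y) S ->
  ~ countable (S `\` exceptional).
Proof.
move=> Sunc Ssep; apply: uncountable_setD => // x y Sx Sy Ex Ey.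
apply: contrapT => xy; have [m [k]] := Ssep x y Sx Sy xy.
exact: exceptional_not_separated.
Qed.

Lemma uncountable_scrambled S : ~ countable S ->
  mt_scrambled (X := T) (R := R) f partitions S ->
  ~ countable (S `\` exceptional).
Proof.
move=> Sunc Sscr; apply: uncountable_nonexceptional => // x y Sx Sy xy.
by have [_ [m [k [_ _ ?]]]] := Sscr x y Sx Sy xy; exists m, k.
Qed.

Lemma uncountable_plus_scrambled S : ~ countable S ->
  mt_plus_scrambled (X := T) (R := R) f partitions S ->
  ~ countable (S `\` exceptional).
Proof.
move=> Sunc Sscr; apply: uncountable_nonexceptional => // x y Sx Sy xy.
have [_ /(_ (1 / 2) ltac:(lra))[m [k [_ _ ?]]]] := Sscr x y Sx Sy xy.
by exists m, k.
Qed.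

End transfer.

Arguments exceptional {R X} f c r w.
Arguments core {R X} f c r w.

Theorem theorem4 (R : realType) (X : pointedMetricType R) (f : X -> X)
    (mu : probability (g_sigma_algebraType (@open X)) R)
    (Xcompact : compact [set: X]) (fcont : continuous f)
    (mu_ergodic : ergodic mu f) :
  [/\ mt_chaotic mu f -> DC2_chaotic f,
      uniformly_mt_chaotic mu f -> uniformly_DC2_chaotic f,
      mt_plus_chaotic mu f -> DC32_chaotic f &
      uniformly_mt_plus_chaotic mu f -> uniformly_DC32_chaotic f].
Proof.
have [c [r balls]] := compact_fine_balls Xcompact.
have thin (p : nat * nat) : exists s, 0 < s /\
    (mu (annulus (c p.1) (r p.1) s) < (p.2.+1%:R^-1)%:E)%E.
  have p0 : 0 < p.2.+1%:R^-1 :> R by rewrite invr_gt0.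
  by have [s s0 ms] := thin_annulus mu (c p.1) (r p.1) _ p0; exists s.
have [w' Hw'] := choice thin; pose w i q := w' (i, q).
have w0 i q : 0 < w i q by have [] := Hw' (i, q).
have wthin i q : (mu (annulus (c i) (r i) (w i q)) < (q.+1%:R^-1)%:E)%E.
  by have [] := Hw' (i, q).
pose E := exceptional f c r w.
have refP := core_refining f mu c r w balls mu_ergodic wthin.
set P := cells _ in refP.
have sep := separation_transfer f c r w w0.
have weak := scrambled_transfer f c r w balls w0.
have plus := plus_scrambled_transfer f c r w balls w0.
split=> /(_ P refP)[S [Sunc]].
- move=> Sscr; exists (S `\` E); split; first exact: uncountable_scrambled.
  exact: weak.
- move=> [Sscr [k [eta [eta0 Su]]]].
  exists (S `\` E); split; first exact: uncountable_scrambled.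
  split; first exact: weak.
  have [||s s0 H] := sep k eta (eta / 2) _ _; [lra|lra|].
  exists s, (eta / 2); split => //; first lra.
  move=> x y [Sx Ex] [Sy Ey] xy; have [m [minc ma msep]] := Su x y Sx Sy xy.
  exact: H msep.
- move=> Sscr; exists (S `\` E); split; first exact: uncountable_plus_scrambled.
  exact: plus.
- move=> [Sscr [k Su]].
  exists (S `\` E); split; first exact: uncountable_plus_scrambled.
  split; first exact: plus.
  (* Density [eta] is obtained by thinning out a sequence of density
     [(1 + eta) / 2], which is larger than [eta] and still less than [1]. *)
  have sP (eta : R) : exists s, 0 < eta < 1 -> 0 < s /\
      forall x y, ~ E x -> ~ E y -> forall m, positive_increasing m ->
        (((1 + eta) / 2)%:E <= upper_density R m)%E ->
        mt_separated_along (X := g_sigma_algebraType (@open X)) f P m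
          (k ((1 + eta) / 2)) x y ->
        exists m', [/\ positive_increasing m', (eta%:E <= upper_density R m')%E &
          top_separated_along f m' s x y].
    have [eta01|] := pselect (0 < eta < 1); last by exists 0.
    have [||s s0 H] := sep (k ((1 + eta) / 2)) ((1 + eta) / 2) eta _ _;
      [lra|lra|by exists s].
  have [s Hs] := choice sP; exists s; split; first by move=> eta /Hs[].
  move=> x y [Sx Ex] [Sy Ey] xy eta eta01; have [_ H] := Hs eta eta01.
  have [m [minc ma msep]] := Su x y Sx Sy xy ((1 + eta) / 2) ltac:(lra).
  exact: H msep.
Qed.
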